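(* Let $X$ be a subspace of an ordinal such that $X$ is homogeneous on its derived set $X'$. Then there exists a linearly ordered topological space $Z$ such that $X$ can be (topologically) embedded into $Z$ and the lexicographical product $Z\times_l Z$ is homeomorphic to the Cartesian product $Z\times Z$.
   Context: Ordinals carry their order topology, and a subspace of an ordinal is a subset with the subspace topology. A linearly ordered topological space (LOTS) is a pair $\langle Z,<\rangle$ of a topological space $Z$ and a linear order $<$ on $Z$ whose induced order topology equals the topology of $Z$. For LOTS $Y$ and $Z$, $Y\times_l Z$ denotes the set of pairs ordered lexicographically ($\langle a,b\rangle<\langle c,d\rangle$ iff $a<c$, or $a=c$ and $b<d$) and endowed with the order topology of this lexicographical order. $Y\times Z$ denotes the usual product with the product topology. $X'$ (the derived set of $X$) is the set of all non-isolated points of $X$. $X$ is homogeneous on its subset $A$ if for every $x,y\in A$ there exists a homeomorphism $f:X\to X$ such that $f(x)=y$ and $f(y)=x$. *)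

(* Defs.v *)
From mathcomp Require Import all_boot all_order all_classical topology.

Set Implicit Arguments.
Unset Strict Implicit.
Unset Printing Implicit Defensive.

Local Open Scope classical_set_scope.

Definition homeomorphism (S T : topologicalType) (f : S -> T) : Prop :=
  exists g : T -> S, [/\ cancel f g, cancel g f, continuous f & continuous g].

Definition homeomorphic (S T : topologicalType) : Prop :=
  exists f : S -> T, homeomorphism f.

(* The subset [A], seen as a type, carries the subspace topology. *)
Definition embeddable (S T : topologicalType) : Prop :=
  exists A : set T, homeomorphic S (set_type A).

Definition derived_set (T : topologicalType) : set T :=
  ~` isolated [set: T].

Arguments derived_set : clear implicits.

Definition homogeneous_on (T : topologicalType) (A : set T) : Prop :=
  forall x y : T, A x -> A y ->
    exists f : T -> T, [/\ homeomorphism f, f x = y & f y = x].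

(* Ordinals are represented, up to order isomorphism, by well-ordered linearly
   ordered spaces: an [orderTopologicalType] is a topological space with a total
   order whose open intervals and rays generate its topology. *)
Definition is_ordinal (d : Order.disp_t) (W : orderTopologicalType d) : Prop :=
  wochoice.well_order (<=%O : rel W).

(* [Z *l Z] is [Z * Z] with the lexicographic order; [order_topology] replaces
   any other topology on the carrier by the order topology. *)
Definition lexi_product (d1 d2 : Order.disp_t) (Y : orderTopologicalType d1)
    (Z : orderTopologicalType d2) : topologicalType :=
  order_topology (Y *l Z).

(* Main.v *)
Require Import Defs.
From mathcomp Require Import all_boot all_order all_classical topology.
From HB Require Import structures.
From mathcomp Require Import ssralg ssrnum ssrint interval.

(* Let x0 be the least non-isolated point of X and I the set of points of X
   below x0.  Then x0 is the only limit point of X up to x0, so homogeneity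
   makes X' discrete: around each limit point x there is a clopen piece,
   homeomorphic to a subspace of I + {x0}; these pieces can be taken disjoint,
   and the other points of X are isolated.
   Take for Z the set of functions I -> S with the lexicographic order, where S
   is an order without end points such that S ~ S * S and S ~ (I -> S) as bare
   sets.  The order topology of Z is that of agreement on initial segments of
   I, so X embeds into Z: a point of the piece around x corresponding to u is
   sent to i |-> (x, i < u), and the label x keeps the pieces apart.  As Z has
   no end points, Z *l Z is the product of the discrete set Z with the space Z.
   Coordinatewise, S ~ S * S gives Z * Z = Z, while Z ~ S as sets and
   S * S ~ S at the least coordinate give (Z discrete) * Z = Z. *)

Set Implicit Arguments.
Unset Strict Implicit.
Unset Printing Implicit Defensive.

Import Order.TTheory.
Local Open Scope classical_set_scope.

(** * Well-orders as ordered types *)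

Lemma well_order_min (T : Type) (R : rel T) (P : T -> Prop) :
  wochoice.well_order R -> (exists x, P x) ->
  exists2 x, P x & forall y, P y -> R x y.
Proof.
move=> woR [x Px]; have [|z [[/asboolP Pz zmin] _]] := woR [pred y | `[<P y>]].
  by exists x; apply/asboolP.
by exists z => // y Py; apply: zmin; apply/asboolP.
Qed.

(** Compare with the least element of [{x, y, z}]: if it is [y] or [z], antisymmetry identifies two
    neighbours of the chain. *)
Lemma well_order_trans (T : eqType) (R : rel T) :
  wochoice.well_order R -> transitive R.
Proof.
move=> woR y x z Rxy Ryz.
have Ranti : antisymmetric R.
  move=> a b; have := @wochoice.wo_chain_antisymmetric T R predT.
  by apply => //; exact: wochoice.withinW.
have [m Pm mmin] := @well_order_min _ _ (fun w => [\/ w = x, w = y | w = z])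
  woR (ex_intro _ x (Or31 _ _ erefl)).
have [mx my mz] : [/\ R m x, R m y & R m z].
  by split; apply: mmin; [apply: Or31|apply: Or32|apply: Or33].
case: Pm => e; subst m => //.
  by rewrite (@Ranti x y) // Rxy mx.
by rewrite -(@Ranti y z) // Ryz my.
Qed.

(** The proof is a parameter of the alias so that order instances, found from the type alone, can
    use it. *)
Definition well_ordered (T : choiceType) (R : rel T)
  (_ : wochoice.well_order R) : Type := T.

Section well_ordered_orderType.
Variables (T : choiceType) (R : rel T) (woR : wochoice.well_order R).

HB.instance Definition _ := Choice.on (well_ordered woR).

Let chainR : wochoice.wo_chain R predT.
Proof. exact: wochoice.withinW. Qed.

Let R_refl : reflexive R.
Proof. by move=> x; apply: (wochoice.wo_chain_reflexive chainR). Qed.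

Let R_anti : antisymmetric R.
Proof. by move=> x y; apply: (wochoice.wo_chain_antisymmetric chainR). Qed.

Let R_total : total R.
Proof. by move=> x y; apply: (wochoice.wo_chainW chainR). Qed.

HB.instance Definition _ := Order.Le_isPOrder.Build (Order.Disp tt tt)
  (well_ordered woR) R_refl R_anti (well_order_trans woR).

HB.instance Definition _ := Order.POrder_isTotal.Build (Order.Disp tt tt)
  (well_ordered woR) R_total.

End well_ordered_orderType.

(** * Cardinal arithmetic for the order [S] *)

Lemma bijective_of_injections (A B : Type) (f : A -> B) (g : B -> A) :
  injective f -> injective g -> exists h : A -> B, bijective h.
Proof.
have card_le_inj (S T : Type) (u : S -> T) :
    injective u -> ([set: S] #<= [set: T])%card.
  move=> inju; have [v] : $|{injfun [set: S] >-> [set: T]}|.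
    by apply/injfunPex; exists u => // x y _ _; exact: inju.
  exact: inj_card_le v.
move=> /card_le_inj AB /card_le_inj BA.
have /card_bijP[h [k hK kH]] := Cantor_Bernstein AB BA.
exists (fun a => val (h (to_setT a))).
exists (fun b => val (k (to_setT b))) => x.
  have -> : to_setT (val (h (to_setT x))) = h (to_setT x) by apply: val_inj.
  by rewrite hK.
have -> : to_setT (val (k (to_setT x))) = k (to_setT x) by apply: val_inj.
by rewrite kH.
Qed.

(* The lexicographic factor [int] removes the end points. *)
Lemma endless_self_power (I D : Type) (i0 i1 : I) : i0 <> i1 ->
  exists (d : Order.disp_t) (S : orderType d),
  [/\ forall s : S, exists a b : S, (a < s)%O /\ (s < b)%O,
      exists h : D -> S, injective h,
      exists h : S -> S * S, bijective h &
      exists h : S -> (I -> S), bijective h].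
Proof.
move=> i01.
(* Codes a pair as a function on [I]; the second entry is read off at [i1]. *)
pose two T (x y : T) i := if `[< i = i0 >] then x else y.
have two_inj T (x y x' y' : T) : two T x y = two T x' y' -> x = x' /\ y = y'.
  move=> e; split; first by have := congr1 (@^~ i0) e; rewrite /two !asboolT.
  by have := congr1 (@^~ i1) e; rewrite /two !asboolF//; exact/nesym.
(* Splitting off the first index of a sequence injects [I -> Q] into [Q]; the summands make room for
   [D] and for the integer coordinate of [S]. *)
pose Q := {classic (nat -> I) -> D + int}.
have [R woR] := wochoice.well_ordering_principle Q.
pose S : orderType _ := (well_ordered woR *l int)%type.
have [Qpow Qpow_inj] : exists u : (I -> Q) -> Q, injective u.
  exists (fun F s => F (s 0) (fun n => s n.+1)) => F G /= FG.
  apply/funext => i; apply/funext => t.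
  have /= := congr1 (fun q => q (fun n => if n is m.+1 then t m else i)) FG.
  exact.
have [SQ SQ_inj] : exists u : S -> Q, injective u.
  exists (fun s => Qpow (two _ s.1 (fun=> inr s.2))) => -[q k] [q' k'] /=.
  by move=> /Qpow_inj/(two_inj _ _ _ _ _)[-> /(congr1 (@^~ (fun=> i0)))[->]].
have QS_inj : injective (fun q : Q => (q, 0%R) : S) by move=> q q' [].
have [Spow Spow_inj] : exists u : (I -> S) -> S, injective u.
  exists (fun F => (Qpow (SQ \o F), 0%R)) => F G [/Qpow_inj FG].
  by apply/funext => i; apply: SQ_inj; have := congr1 (@^~ i) FG.
exists _, S; split.
- move=> [q k]; exists (q, (k - 1)%R), (q, (k + 1)%R).
  by rewrite !ltEprodlexi/= lexx/= Num.Theory.gtrBl Num.Theory.ltrDl.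
- by exists (fun x => ((fun=> inl x) : Q, 0%R)) => x y
    [/(congr1 (@^~ (fun=> i0)))[]].
- apply: (@bijective_of_injections _ _ (fun s => (s, s))
    (fun st => Spow (two _ st.1 st.2))).
    by move=> s t [].
  by move=> [s t] [s' t'] /Spow_inj/(two_inj _ _ _ _ _)[/= -> ->].
- apply: (bijective_of_injections _ Spow_inj (f := fun s=> fun=> s)) => s t.
  exact: (congr1 (@^~ i0)).
Qed.

(** * The lexicographic order on functions from a well-order *)

Section lexicographic_functions.
Context {dI : Order.disp_t} {I : orderType dI}
  (woI : wochoice.well_order (<=%O : rel I))
  {dS : Order.disp_t} (S : orderType dS).

Definition lexfun of wochoice.well_order (<=%O : rel I) : Type := I -> S.
Local Notation F := (lexfun woI).

HB.instance Definition _ := gen_eqMixin F.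
HB.instance Definition _ := gen_choiceMixin F.

Definition lexfun_lt (f g : F) :=
  `[< exists2 i : I, (forall j, (j < i)%O -> f j = g j) & (f i < g i)%O >].

Lemma lexfun_lt_irr : irreflexive lexfun_lt.
Proof. by move=> f; apply/asboolP => -[i _]; rewrite ltxx. Qed.

Lemma lexfun_lt_trans : transitive lexfun_lt.
Proof.
move=> g f h /asboolP[i fg fgi] /asboolP[j gh ghj]; apply/asboolP.
have [ij|ji|ij] := ltgtP i j.
- exists i; last by rewrite -gh.
  by move=> k ki; rewrite fg// gh//; apply: lt_trans ij.
- exists j; last by rewrite fg.
  by move=> k kj; rewrite fg ?gh//; apply: lt_trans ji.
- exists i; last by rewrite (lt_trans fgi)// ij.
  by move=> k ki; rewrite fg// gh// -ij.
Qed.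

HB.instance Definition _ := Order.Lt_isPOrder.Build (Order.Disp tt tt) F
  lexfun_lt_irr lexfun_lt_trans.

Lemma lexfun_le_total : total (<=%O : rel F).
Proof.
move=> f g; have [->|/eqP fg] := eqVneq f g; first by rewrite lexx.
have [|i /eqP fgi imin] :=
    well_order_min (P := fun i => f i <> g i) woI.
  by apply/existsNP => e; apply: fg; apply/funext.
have eqlt j : (j < i)%O -> f j = g j.
  by move=> ji; apply: contrapT => fgj; have := imin j fgj; rewrite leNgt ji.
have : (f < g)%O || (g < f)%O.
  move: fgi; rewrite neq_lt => /orP[fgi|gfi]; apply/orP; [left|right];
    apply/asboolP; exists i => // j ji; by rewrite eqlt.
by case/orP => /ltW ->; rewrite ?orbT.
Qed.

HB.instance Definition _ := Order.POrder_isTotal.Build (Order.Disp tt tt) F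
  lexfun_le_total.

End lexicographic_functions.

(** * Neighbourhoods in orders without end points *)

(** The points on both sides of [x] cut every ray around [x] down to a bounded interval. *)
Lemma endless_nbhs (d : Order.disp_t) (T : orderTopologicalType d) (x : T)
    (U : set T) :
  (exists a b : T, (a < x)%O /\ (x < b)%O) ->
  nbhs x U <->
  exists a b : T, [/\ (a < x)%O, (x < b)%O &
    forall y, (a < y)%O -> (y < b)%O -> U y].
Proof.
move=> [a0 [b0 [a0x xb0]]]; rewrite itv_nbhsE; split; last first.
  move=> [a [b [ax xb abU]]]; exists `]a, b[%O.
    by rewrite in_itv/= ax xb.
  by move=> y /=; rewrite in_itv/= => /andP[]; exact: abU.
move=> [[l r] [+ xlr] lrU].
case: l r xlr lrU => [[]a|[]] [[]b|[]] //=;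
  rewrite !in_itv/= ?andbT => xab abU _.
- move: xab => /andP[? ?]; exists a, b; split=> // y ay yb.
  by apply: abU; rewrite /= in_itv/= ay.
- exists a, b0; split=> // y ay _.
  by apply: abU => /=; rewrite in_itv/= ay.
- exists a0, b; split=> // y _ yb.
  by apply: abU => /=; rewrite in_itv/= yb.
- by exists a0, b0; split=> // y _ _; apply: abU; rewrite /= in_itv.
Qed.

(** Without end points in [Z], every fibre over a point of [Y] is open, so the lexicographic product
    is a disjoint sum of copies of [Z]. *)
Lemma lexi_product_nbhs (d1 d2 : Order.disp_t) (Y : orderTopologicalType d1)
    (Z : orderTopologicalType d2) (x : lexi_product Y Z)
    (U : set (lexi_product Y Z)) :
  (forall z : Z, exists a b : Z, (a < z)%O /\ (z < b)%O) ->
  nbhs x U <-> nbhs x.2 [set z : Z | U (x.1, z)].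
Proof.
move=> Zendless; case: x => f g /=.
pose T : orderTopologicalType _ := order_topology (Y *l Z).
have lt_fst p q : (p < q)%O -> @Order.lt _ T (f, p) (f, q).
  by move=> pq; rewrite ltEprodlexi/= lexx.
have [a0 [b0 [a0g gb0]]] := Zendless g.
rewrite (@endless_nbhs _ T) ?(endless_nbhs _ (Zendless g)); last first.
  by exists (f, a0), (f, b0); split; exact: lt_fst.
split=> [[[a1 a2] [[b1 b2] [ax xb abU]]]|[a [b [ag gb ab]]]]; last first.
  exists (f, a), (f, b); split; [exact: lt_fst|exact: lt_fst|].
  move=> [p q]; rewrite !ltEprodlexi/= => /andP[fp apq] /andP[pf pqb].
  have fpE : f = p by apply/le_anti; rewrite fp pf.
  by rewrite -fpE; apply: ab; [move: apq; rewrite pf|move: pqb; rewrite fp].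
(* If [a1 < f], the whole fibre over [f] lies above the left end, and any [a0 < g] will do. *)
have [a [ag aU]] : exists a : Z, (a < g)%O /\
    forall q : Z, (a < q)%O -> @Order.lt _ T (a1, a2) (f, q).
  move: ax; rewrite ltEprodlexi/= => /andP[].
  rewrite le_eqVlt => /orP[/eqP->|a1f _].
    by rewrite lexx/= => ag; exists a2; split => // q; exact: lt_fst.
  exists a0; split => // q _.
  by rewrite ltEprodlexi/= ltW//= leNgt a1f.
have [b [gb bU]] : exists b : Z, (g < b)%O /\
    forall q : Z, (q < b)%O -> @Order.lt _ T (f, q) (b1, b2).
  move: xb; rewrite ltEprodlexi/= => /andP[].
  rewrite le_eqVlt => /orP[/eqP<-|fb1 _].
    by rewrite lexx/= => gb; exists b2; split => // q; exact: lt_fst.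
  exists b0; split => // q _.
  by rewrite ltEprodlexi/= ltW//= leNgt fb1.
by exists a, b; split=> // q aq qb; apply: abU; [exact: aU|exact: bU].
Qed.

(** * The topology of agreement on initial segments *)

Section lexfun_topology.
Context {dI : Order.disp_t} {I : orderType dI}
  (woI : wochoice.well_order (<=%O : rel I))
  (Iendless : forall i : I, exists j : I, (i < j)%O)
  {dS : Order.disp_t} (S : orderType dS)
  (Sendless : forall s : S, exists a b : S, (a < s)%O /\ (s < b)%O).

Definition lexspace : Type := order_topology (lexfun S woI).
HB.instance Definition _ := OrderTopological.on lexspace.
Local Notation Z := lexspace.

Definition agree (i : I) (f g : Z) := forall j, (j <= i)%O -> f j = g j.

Lemma lexspace_ltE (f g : Z) : (f < g)%O =
  `[< exists2 i : I, (forall j, (j < i)%O -> f j = g j) & (f i < g i)%O >].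
Proof. by []. Qed.

(** Lower and raise [f] at a single index [k] beyond [i]: what lies between the two results cannot
    leave [f] before [k]. *)
Lemma lexspace_squeeze (f : Z) (i : I) :
  exists a b : Z, [/\ (a < f)%O, (f < b)%O &
    forall g : Z, (a < g)%O -> (g < b)%O -> agree i f g].
Proof.
have [k ik] := Iendless i; have [s [t [sf ft]]] := Sendless (f k).
pose upd (s : S) : Z := fun j => if j == k then s else f j.
have updk s' : upd s' k = s' by rewrite /upd eqxx.
have upd_lt s' j : (j < k)%O -> upd s' j = f j.
  by move=> jk; rewrite /upd lt_eqF.
exists (upd s), (upd t); split.
- rewrite lexspace_ltE; apply/asboolP; exists k; last by rewrite updk.
  by move=> j jk; rewrite upd_lt.
- rewrite lexspace_ltE; apply/asboolP; exists k; last by rewrite updk.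
  by move=> j jk; rewrite upd_lt.
(* [g] leaves the lower bound at [m], upwards, and the upper bound at [n], downwards. If both were
   below [k], the earlier of them would contradict agreement with the other bound. *)
move=> g; rewrite !lexspace_ltE => /asboolP[m sgm sgmlt] /asboolP[n gtn gtnlt].
have [kn|nk] := leP k n.
  by move=> j /le_lt_trans/(_ ik) jk; rewrite gtn ?upd_lt// (lt_le_trans jk).
have [km|mk] := leP k m.
  move=> j /le_lt_trans/(_ ik) jk; rewrite -sgm ?upd_lt//.
  exact: lt_le_trans km.
move: sgmlt gtnlt; rewrite !upd_lt// => fgm gfn.
have [mn|nm|mn] := ltgtP m n.
- by move: fgm; rewrite gtn// upd_lt// ltxx.
- by move: gfn; rewrite -sgm// upd_lt// ltxx.
- by move: fgm; rewrite mn => /lt_trans/(_ gfn); rewrite ltxx.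
Qed.

Lemma lexspace_endless (i0 : I) (f : Z) :
  exists a b : Z, (a < f)%O /\ (f < b)%O.
Proof. by have [a [b [af fb _]]] := lexspace_squeeze f i0; exists a, b. Qed.

(** One direction is the squeeze. For the other, the comparisons of [f] with the ends of an interval
    are decided at two indices, and agreement up to their maximum preserves both. *)
Lemma lexspace_nbhs (i0 : I) (f : Z) (U : set Z) :
  nbhs f U <-> exists i, agree i f `<=` U.
Proof.
rewrite endless_nbhs; last exact: lexspace_endless.
split=> [[a [b [af fb abU]]]|[i fiU]]; last first.
  have [a [b [af fb ab]]] := lexspace_squeeze f i.
  by exists a, b; split => // g ag gb; exact/fiU/ab.
move: af fb; rewrite !lexspace_ltE.
move=> /asboolP[m afm afmlt] /asboolP[n fbn fbnlt].
exists (Order.max m n) => g fg; apply: abU; rewrite lexspace_ltE; apply/asboolP.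
- exists m; last by rewrite -fg// le_max lexx.
  by move=> j jm; rewrite afm// fg// le_max ltW.
- exists n; last by rewrite -fg// le_max lexx orbT.
  by move=> j jn; rewrite -fbn// fg// le_max (ltW jn) orbT.
Qed.

Lemma lexspace_homeomorphic (i0 : I) (S2 : S -> S * S) (SI : S -> (I -> S)) :
  (forall i, (i0 <= i)%O) -> bijective S2 -> bijective SI ->
  homeomorphic (lexi_product lexspace lexspace) (lexspace * lexspace)%type.
Proof.
move=> i0min [p S2K pK] [c SIK cK].
(* The discrete factor [f] is coded as one element of [S] and stored at the least index, which
   belongs to every initial segment. *)
pose put (f g : Z) : Z := fun i => if i == i0 then p (c f, g i0) else g i.
pose Phi (x : lexi_product lexspace lexspace) : (Z * Z)%type :=
  (fun i => (S2 (put x.1 x.2 i)).1, fun i => (S2 (put x.1 x.2 i)).2).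
pose join (y : Z * Z) : Z := fun i => p (y.1 i, y.2 i).
pose Psi (y : Z * Z) : lexi_product lexspace lexspace :=
  (SI (S2 (join y i0)).1,
   fun i => if i == i0 then (S2 (join y i0)).2 else join y i).
have joinPhi x : join (Phi x) = put x.1 x.2.
  by apply/funext => i; rewrite /join -surjective_pairing S2K.
have putPsi y : put (Psi y).1 (Psi y).2 = join y.
  apply/funext => i; rewrite /put /=; have [->|//] := eqVneq i i0.
  by rewrite eqxx SIK -surjective_pairing S2K.
exists Phi, Psi; split.
- move=> [f g]; rewrite /Psi joinPhi /put eqxx pK /= cK; congr pair.
  by apply/funext => i; have [->|//] := eqVneq i i0.
- move=> y; rewrite /Phi putPsi /join.
  by case: y => f g /=; congr pair; apply/funext => i; rewrite pK.
- move=> [f g] U [[A B] /= [+ +] ABU].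
  move=> /(lexspace_nbhs i0)[i iA] /(lexspace_nbhs i0)[j jB].
  apply/(lexi_product_nbhs _ _ (lexspace_endless i0))/(lexspace_nbhs i0) => /=.
  exists (Order.max i j) => h /= gh.
  have put_eq k : (k <= Order.max i j)%O -> put f g k = put f h k.
    by move=> kij; rewrite /put (gh k kij) (gh i0 (i0min _)).
  apply: ABU; split; [apply: iA|apply: jB] => k kij /=; rewrite put_eq//.
    by rewrite le_max kij.
  by rewrite le_max kij orbT.
- move=> [f g] U.
  move=> /(lexi_product_nbhs _ _ (lexspace_endless i0)) /=.
  move=> /(lexspace_nbhs i0)[i iU].
  exists ([set f' | agree i f f'], [set g' | agree i g g']).
    by split; apply/(lexspace_nbhs i0); exists i.
  move=> [f' g'] [/= ff' gg'].
  have join_eq k : (k <= i)%O -> join (f', g') k = join (f, g) k.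
    by move=> ki; rewrite /join/= ff'// gg'.
  (* Agreement at [i0] already makes the first components equal, so both images lie in one fibre. *)
  rewrite /= /Psi join_eq//.
  by apply: iU => k ki /=; rewrite !join_eq.
Qed.

End lexfun_topology.

(** * An embedding criterion and the existence of [Z] *)

Lemma embeddable_of_nbhs (T U : topologicalType) (e : T -> U) :
  injective e -> continuous e ->
  (forall x N, nbhs x N -> exists2 M, nbhs (e x) M & e @^-1` M `<=` N) ->
  embeddable T U.
Proof.
move=> einj econt eopen; exists (range e).
have reP (x : T) : e x \in range e by rewrite inE; exists x.
have rng (y : range e) : {x | e x = val y}.
  by apply: cid; have [x _ <-] := set_valP y; exists x.
exists (fun x => exist _ (e x) (reP x) : range e), (fun y => sval (rng y)).
have gK y : e (sval (rng y)) = val y := svalP (rng y).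
split.
- by move=> x; apply: einj; rewrite gK.
- by move=> y; apply: val_inj; exact: gK.
- move=> x N [_ [[V Vo <-] /=] Vex VN].
  apply: filterS VN _ => /=.
  exact: (econt x V (open_nbhs_nbhs (conj Vo Vex))).
- move=> y N /eopen[M]; rewrite gK => Mn MN.
  have : nbhs y (val @^-1` M) by exact: (@initial_continuous _ _ val y M Mn).
  by apply: filterS => z Mz; apply: MN; rewrite /= gK.
Qed.

(** All that the embeddings need to know of [Z]: the last two clauses make [e] an embedding of
    [I -> D] with the topology of agreement on initial segments. *)
Lemma exists_homeomorphic_squares (dI : Order.disp_t) (I : orderType dI)
    (i0 : I) (D : Type) :
  wochoice.well_order (<=%O : rel I) ->
  (forall i : I, exists j : I, (i < j)%O) ->
  exists (d : Order.disp_t) (Z : orderTopologicalType d) (e : (I -> D) -> Z),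
  [/\ homeomorphic (lexi_product Z Z) (Z * Z)%type,
      forall f U, nbhs (e f) U ->
        exists i, forall g, (forall j, (j <= i)%O -> f j = g j) -> U (e g) &
      forall f i, exists2 U, nbhs (e f) U &
        forall g, U (e g) -> forall j, (j <= i)%O -> f j = g j].
Proof.
move=> woI Iendless.
have [m _ mmin] := well_order_min woI (ex_intro (fun=> True) i0 Logic.I).
have {}mmin i : (m <= i)%O by exact: mmin.
have [m' mm'] := Iendless m.
have [|d [S [Sendless [c c_inj] [S2 S2bij] [SI SIbij]]]] :=
  @endless_self_power I D m m'.
  by move=> e; move: mm'; rewrite e ltxx.
exists _, (lexspace woI S), (fun f i => c (f i)); split.
- exact: (lexspace_homeomorphic woI Iendless Sendless mmin S2bij SIbij).
- move=> f U /(lexspace_nbhs Iendless Sendless i0)[i iU]; exists i => g fg.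
  by apply: iU => j ji; rewrite fg.
- move=> f i; exists (agree (i : I) ((fun k => c (f k)) : lexspace woI S)).
    by apply/(lexspace_nbhs Iendless Sendless i0); exists i.
  by move=> g fg j ji; apply/c_inj/fg.
Qed.

Lemma homeomorphism_nbhs (T U : topologicalType) (f : T -> U) (g : U -> T) x N :
  cancel f g -> cancel g f -> continuous f -> continuous g ->
  nbhs (f x) N <-> nbhs x (f @^-1` N).
Proof.
move=> fK gK fc gc; split; first exact: fc.
move=> xN; have gN : nbhs (f x) (g @^-1` (f @^-1` N)) by apply: gc; rewrite fK.
by apply: filterS gN => y /=; rewrite gK.
Qed.

(** * Neighbourhoods in a subspace of an ordinal *)

Section ordinal_subspace.
Context {d : Order.disp_t} {W : orderTopologicalType d}
  (W_ordinal : is_ordinal W) (X : set W).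
Implicit Types (x y a : X).

Lemma derived_setP x : derived_set X x <-> ~ nbhs x [set x].
Proof.
split=> [nx xx|nx [_ [V xV VE]]]; apply: nx.
  by split; [rewrite inE|exists [set x]; rewrite ?setIT].
by rewrite setIT in VE; rewrite -VE.
Qed.

Lemma not_derived_set x : ~ derived_set X x -> nbhs x [set x].
Proof. by move=> /derived_setP/contrapT. Qed.

(** The points up to [x] are those below its successor, or all points if [x] has none. *)
Lemma ordinal_subspace_nbhs_le x : nbhs x [set y | (val y <= val x)%O].
Proof.
suff : nbhs (val x) [set w | (w <= val x)%O].
  exact: (@initial_continuous _ _ val x).
have [[w xw]|xmax] := pselect (exists w : W, (val x < w)%O).
  have [|s xs smin] := well_order_min (P := fun w => (val x < w)%O) W_ordinal.
    by exists w.
  have : nbhs (val x) `]-oo, s[%classic.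
    by apply: open_nbhs_nbhs; split; [exact: lray_open|rewrite /= in_itv].
  apply: filterS => z /=; rewrite in_itv/= => zs.
  by rewrite leNgt; apply/negP => /smin; rewrite leNgt zs.
apply: filterS filterT => z _ /=.
by rewrite leNgt; apply/negP => xz; apply: xmax; exists z.
Qed.

Lemma ordinal_subspace_nbhs_gt a x : (val a < val x)%O ->
  nbhs x [set y | (val a < val y)%O].
Proof.
move=> ax; apply: (@initial_continuous _ _ val x [set w | (val a < w)%O]).
have : nbhs (val x) `]val a, +oo[%classic.
  by apply: open_nbhs_nbhs; split; [exact: rray_open|rewrite /= in_itv/= ax].
by apply: filterS => z /=; rewrite in_itv/= andbT.
Qed.

(** Limit points are approached from below: an interval around [x] without smaller points of [X]
    would isolate [x], as the points up to [x] form a neighbourhood. *)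
Lemma ordinal_subspace_nbhs x N : derived_set X x -> nbhs x N ->
  exists2 a : X, (val a < val x)%O &
    forall y : X, (val a <= val y)%O -> (val y <= val x)%O -> N y.
Proof.
move=> /derived_setP dx [_ [[V Vo <-] /= Vx] VN].
have : nbhs (val x) V by exact: open_nbhs_nbhs.
rewrite itv_nbhsE => -[[l r] [lr xlr] lrV].
have [a [alr ax]] : exists a : X, (val a \in Interval l r) /\ (val a < val x)%O.
  apply/not_existsP => none; apply: dx.
  have xlrX : nbhs x [set y | val y \in Interval l r].
    apply: (@initial_continuous _ _ val x [set` Interval l r]).
    rewrite itv_nbhsE; by exists (Interval l r).
  apply: filterS (filterI xlrX (ordinal_subspace_nbhs_le x)) => y /= [ylr yx].
  apply: val_inj; apply/eqP; rewrite eq_le yx leNgt.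
  by apply/negP => yx'; apply: (none y).
exists a => // y ay yx; apply: VN; apply: lrV => /=.
move: alr xlr; rewrite !itv_boundlr => /andP[la _] /andP[_ xr].
apply/andP; split; first by rewrite (le_trans la)// bnd_simp.
by rewrite (le_trans _ xr)// bnd_simp.
Qed.

(** Being T0, [X] inherits injectivity of a map from its openness onto the image. *)
Lemma ordinal_subspace_separated x y :
  (forall N, nbhs x N -> N y) -> (forall N, nbhs y N -> N x) -> x = y.
Proof.
move=> /(_ _ (ordinal_subspace_nbhs_le x)) yx.
move=> /(_ _ (ordinal_subspace_nbhs_le y)) xy.
by apply/val_inj/le_anti; rewrite /= xy yx.
Qed.

Lemma ordinal_subspace_min (P : X -> Prop) : (exists x, P x) ->
  exists2 x, P x & forall y, P y -> (val x <= val y)%O.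
Proof.
move=> [x Px]; have [|_ [z <- Pz] zmin] := @well_order_min _ _
    (fun w => exists2 z, val z = w & P z) W_ordinal.
  by exists (val x), x.
by exists z => // y Py; apply: zmin; exists y.
Qed.

End ordinal_subspace.

Lemma well_order_sub (d : Order.disp_t) (W : orderType d) (A : set W) :
  wochoice.well_order (<=%O : rel W) ->
  wochoice.well_order (@Order.le d (sub_type A)).
Proof.
move=> woW; apply: wochoice.antisymmetric_well_order; first exact: le_anti.
move=> P [x Px]; have [|_ [z <- Pz] zmin] := @well_order_min _ _
    (fun w => exists2 z : sub_type A, val z = w & z \in P) woW.
  by exists (val x), x.
by exists z; split=> // y Py; apply: zmin; exists y.
Qed.

(** * The embedding when limit points exist *)

Section homogeneous_embedding.
Context {d : Order.disp_t} {W : orderTopologicalType d}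
  (W_ordinal : is_ordinal W) (X : set W) (x0 : X)
  (x0_derived : derived_set X x0)
  (x0_min : forall x, derived_set X x -> (val x0 <= val x)%O)
  (F G : X -> X -> X)
  (FG : forall x, derived_set X x -> [/\ cancel (F x) (G x), cancel (G x) (F x),
     continuous (F x), continuous (G x) & F x x0 = x]).
Implicit Types (x y u : X).

Let G_x0 x : derived_set X x -> G x x = x0.
Proof. by move=> /FG[FK _ _ _ Fx0]; rewrite -{2}Fx0 FK. Qed.

Let G_derived x y : derived_set X x -> derived_set X y -> derived_set X (G x y).
Proof.
move=> /FG[FK GK Fc Gc _] /derived_setP dy; apply/derived_setP => xN; apply: dy.
move: xN; rewrite (homeomorphism_nbhs y _ GK FK Gc Fc).
by apply: filterS => z; exact: (can_inj GK).
Qed.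

(** [G x] preserves limit points and [x0] is the least one, so [G x y] can only be [x0], the image
    of [x]. *)
Let derived_le_x0 x y : derived_set X x -> derived_set X y ->
  (val (G x y) <= val x0)%O -> y = x.
Proof.
move=> dx dy Gy; have [_ GK _ _ <-] := FG dx; rewrite -[y in LHS]GK; congr F.
by apply/val_inj/le_anti; rewrite /= Gy x0_min//; exact: G_derived.
Qed.

(* Minimality of [x] among the limit points above [y] makes the pieces
   disjoint. *)
Definition piece x y := [/\ derived_set X x, (val y <= val x)%O,
  forall x', derived_set X x' -> (val y <= val x')%O -> (val x <= val x')%O &
  (val (G x y) <= val x0)%O].

Lemma piece_derived x : derived_set X x -> piece x x.
Proof. by move=> dx; split=> //; rewrite G_x0. Qed.

Lemma piece_uniq x x' y : piece x y -> piece x' y -> x = x'.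
Proof.
move=> [dx yx xmin _] [dx' yx' xmin' _]; apply/val_inj/le_anti => /=.
by rewrite xmin// xmin'.
Qed.

(** On a short interval ending at [x], [G x] stays below or at [x0]; so [x] is the only limit point
    there, hence the least one above each [y] in it. *)
Lemma piece_nbhs x : derived_set X x -> nbhs x (piece x).
Proof.
move=> dx; have [FK GK Fc Gc Fx0] := FG dx.
have /(ordinal_subspace_nbhs W_ordinal dx)[a ax aN] :
    nbhs x [set y | (val (G x y) <= val x0)%O].
  apply: (Gc x [set u | (val u <= val x0)%O]); rewrite G_x0//.
  exact: ordinal_subspace_nbhs_le.
apply: filterS (filterI (ordinal_subspace_nbhs_gt ax)
  (ordinal_subspace_nbhs_le W_ordinal x)) => y /= [ay yx]; split=> //;
  last exact/aN/yx/ltW.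
move=> x' dx' yx'; rewrite leNgt; apply/negP => xx'.
have := derived_le_x0 dx dx' (aN x' (ltW (lt_le_trans ay yx')) (ltW xx')).
by move=> e; move: xx'; rewrite e ltxx.
Qed.

Lemma homogeneous_embedding :
  exists (d' : Order.disp_t) (Z : orderTopologicalType d'),
    embeddable X Z /\ homeomorphic (lexi_product Z Z) (Z * Z)%type.
Proof.
pose A := [set w | X w /\ (w < val x0)%O].
pose I : orderType d := sub_type A.
have inI u : (val u < val x0)%O -> {i : I | val i = val u}.
  move=> ux0; have uA : val u \in A.
    by rewrite inE; split => //; exact: set_valP.
  by exists (exist _ (val u) uA).
have Iin (i : I) : {u : X | val u = val i & (val u < val x0)%O}.
  case: i => w wA /=; have [Xw wx0] := set_mem wA.
  by exists (exist _ w (mem_set Xw)).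
have woI : wochoice.well_order (<=%O : rel I) by exact: well_order_sub.
have [a0 a0x0 _] := ordinal_subspace_nbhs W_ordinal x0_derived filterT.
(* The limit point [x0] is approached from below, so no point of [X] below it is the largest. *)
have Iendless (i : I) : exists j : I, (i < j)%O.
  have [u ui ux0] := Iin i.
  have [a ax0 aN] := ordinal_subspace_nbhs W_ordinal x0_derived
    (ordinal_subspace_nbhs_gt ux0).
  have [j ja] := inI _ ax0; exists j.
  rewrite -[(i < j)%O]/(val i < val j)%O ja -ui.
  exact: aN (lexx _) (ltW ax0).
have [d' [Z [e [ZZ eopen econt]]]] :=
  exists_homeomorphic_squares (sval (inI _ a0x0)) (X * bool)%type woI Iendless.
exists d', Z; split => //.
(* [p y] is the label of the piece and the position in it. A point outside all pieces is its own
   label, with the arbitrary position [a0] below [x0]. *)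
have [p pE] : {p : X -> X * X & forall y,
    (piece (p y).1 y /\ (p y).2 = G (p y).1 y) \/
    ((forall x, ~ piece x y) /\ p y = (y, a0))}.
  apply: (@choice _ _ (fun y q => (piece q.1 y /\ q.2 = G q.1 y) \/
    ((forall x, ~ piece x y) /\ q = (y, a0)))) => y.
  have [[x xy]|none] := pselect (exists x, piece x y).
    by exists (x, G x y); left.
  by exists (y, a0); right; split => // x xy; apply: none; exists x.
have p_piece x y : piece x y -> p y = (x, G x y).
  move=> xy; have [[py e2]|[/(_ _ xy)//]] := pE y.
  by rewrite [LHS]surjective_pairing e2 (piece_uniq py xy).
have p_le y : (val (p y).2 <= val x0)%O.
  by have [[[_ _ _ ?] ->]|[_ ->]] := pE y => //; exact: ltW.
pose phi y (i : I) := ((p y).1, (val i < val (p y).2)%O).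
(* The value false at the position of [y] bounds the position of [z] by it; then the value at the
   position of [z] gives the reverse bound. *)
have phi2_inj y z (i : I) : val i = val (p y).2 ->
    (forall j, (j <= i)%O -> phi y j = phi z j) -> p y = p z.
  move=> iy yz; have [p1 /esym] := yz i (lexx i); rewrite iy ltxx => /negbT.
  rewrite -leNgt => zy; have ix0 : (val i < val x0)%O.
    by have [u <-] := Iin i.
  rewrite iy in ix0; have [j jz] := inI _ (le_lt_trans zy ix0).
  have ji : (j <= i)%O by have : (val j <= val i)%O by rewrite jz iy.
  have [_] := yz j ji; rewrite jz ltxx => /negbT; rewrite -leNgt => yz2.
  rewrite [LHS]surjective_pairing [RHS]surjective_pairing p1; congr pair.
  by apply/val_inj/le_anti; rewrite /= zy yz2.
(* Labels of the two kinds never clash: a limit point lies in its own piece. *)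
have p_inj y z : p y = p z -> y = z.
  have noself t : derived_set X t -> (forall x, ~ piece x t) -> False.
    by move=> /piece_derived tt /(_ t).
  have [[py ey]|[ny ey]] := pE y; have [[pz ez]|[nz ez]] := pE z.
  - move=> pyz; have [dy _ _ _] := py; have [_ GK _ _ _] := FG dy.
    by apply: (can_inj GK); rewrite -ey pyz ez.
  - move=> pyz; move: py; rewrite pyz ez /= => -[dz _ _ _].
    by case: (noself z dz nz).
  - move=> pyz; move: pz; rewrite -pyz ey /= => -[dy _ _ _].
    by case: (noself y dy ny).
  - by rewrite ey ez => -[].
have openI x N : nbhs x N -> exists2 M, nbhs (e (phi x)) M &
    (e \o phi) @^-1` M `<=` N.
  move=> xN; have [dx|ndx] := pselect (derived_set X x).
    have [FK GK Fc Gc Fx0] := FG dx.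
    have : nbhs x0 (F x @^-1` N) by apply: Fc; rewrite Fx0.
    move=> /(ordinal_subspace_nbhs W_ordinal x0_derived)[a ax0 aN].
    (* Agreement up to [a] forces the label [x] and a position beyond [a]; [F x] maps such positions
       into [N]. *)
    have [i ia] := inI _ ax0.
    have [M xM MN] := econt (phi x) i; exists M => // y /MN/(_ i (lexx _)).
    rewrite /phi (p_piece x x (piece_derived dx))/= G_x0// ia ax0.
    move=> -[px1 /esym py2].
    have [[[_ _ _ Gy] e2]|[ny ey]] := pE y; last first.
      by move: px1; rewrite ey /= => <-; exact: nbhs_singleton.
    rewrite -px1 in Gy e2; rewrite -(GK y).
    by apply: aN => //; rewrite -e2 ltW.
  (* The position [x0] belongs only to the label itself, a limit point; so the position of an
     isolated [x] is an index. *)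
  have px0 : (val (p x).2 < val x0)%O.
    have [[[dp _ _ Gx] e2]|[_ ->//]] := pE x.
    have [_ GK _ _ Fx0] := FG dp.
    rewrite lt_neqAle p_le andbT; apply/eqP => /val_inj p2; apply: ndx.
    by rewrite -(GK x) -e2 p2 Fx0.
  have [i ip] := inI _ px0.
  have [M xM MN] := econt (phi x) i; exists M => // y /MN/(phi2_inj _ _ _ ip).
  by move=> /p_inj <-; exact: nbhs_singleton.
apply: (@embeddable_of_nbhs _ _ (e \o phi)) => //.
- move=> x y exy; apply: (ordinal_subspace_separated W_ordinal) => N /openI[M].
    by move=> xM; apply; rewrite /= -[e _]exy; exact: nbhs_singleton.
  by move=> yM; apply; rewrite /= [e _]exy; exact: nbhs_singleton.
- move=> x N /= /eopen[i iN].
  have [dx|/not_derived_set] := pselect (derived_set X x); last first.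
    by apply: filterS => _ -> /=; exact: iN.
  (* [phi x] is constantly [(x, true)], and [phi y] takes this value up to [i] once [y] is in the
     piece of [x] with position beyond [u]. *)
  have [u ui ux0] := Iin i; have [FK GK Fc Gc Fx0] := FG dx.
  have xu : nbhs x [set y | (val u < val (G x y))%O].
    apply: (Gc x [set v | (val u < val v)%O]); rewrite G_x0//.
    exact: ordinal_subspace_nbhs_gt.
  apply: filterS (filterI xu (piece_nbhs dx)) => y /= [uy xy].
  apply: iN => j ji.
  rewrite /phi (p_piece _ _ xy) (p_piece _ _ (piece_derived dx)) /= G_x0//.
  have ju : (val j <= val u)%O by rewrite ui.
  by rewrite (le_lt_trans ju ux0) (le_lt_trans ju uy).
Qed.
End homogeneous_embedding.

(** * Choice of the homeomorphisms, and the discrete case *)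

Theorem theorem2p7 (d : Order.disp_t) (W : orderTopologicalType d)
    (W_ordinal : is_ordinal W) (X : set W)
    (X_homogeneous : homogeneous_on (derived_set (set_type X))) :
  exists (d' : Order.disp_t) (Z : orderTopologicalType d'),
    embeddable (set_type X) Z /\
    homeomorphic (lexi_product Z Z) (Z * Z)%type.
Proof.
have [Xder|Xdisc] := pselect (exists x, derived_set X x).
  have [x0 dx0 x0min] := ordinal_subspace_min W_ordinal Xder.
  have [FG FGP] : {FG : X -> (X -> X) * (X -> X) & forall x,
      derived_set X x -> [/\ cancel (FG x).1 (FG x).2, cancel (FG x).2 (FG x).1,
      continuous (FG x).1, continuous (FG x).2 & (FG x).1 x0 = x]}.
    apply: (@choice _ _ (fun x FG => derived_set X x -> [/\ cancel FG.1 FG.2,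
      cancel FG.2 FG.1, continuous FG.1, continuous FG.2 & FG.1 x0 = x])) => x.
    have [dx|ndx] := pselect (derived_set X x); last by exists (id, id).
    have [f [[g [fK gK fc gc]] fx0 _]] := X_homogeneous x0 x dx0 dx.
    by exists (f, g).
  exact: (homogeneous_embedding W_ordinal dx0 x0min FGP).
have discr (x : X) : nbhs x [set x].
  by apply: not_derived_set => dx; apply: Xdisc; exists x.
(* Without limit points, [nat] serves as index set and each point goes to a constant function; index
   [0] already separates these. *)
have wo_nat : wochoice.well_order (<=%O : rel nat).
  apply: wochoice.antisymmetric_well_order; first exact: le_anti.
  move=> P exP; have [m Pm mmin] := ex_minnP exP.
  by exists m; split.
have [d' [Z [e [ZZ eopen econt]]]] := exists_homeomorphic_squares 0 X wo_nat
  (fun n => ex_intro _ n.+1 (ltnSn n)).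
exists d', Z; split=> //.
have e_inj (x : X) N : nbhs x N -> exists2 M, nbhs (e (fun=> x)) M &
    (fun y => e (fun=> y)) @^-1` M `<=` N.
  move=> xN; have [M xM MN] := econt (fun=> x) 0.
  by exists M => // y /MN/(_ 0 (lexx _)) <-; exact: nbhs_singleton.
apply: (@embeddable_of_nbhs _ _ (fun x => e (fun=> x))) => //.
- move=> x y exy; have [M xM MN] := e_inj x _ (discr x).
  by apply/esym/MN; rewrite /= -exy; exact: nbhs_singleton.
- by move=> x N /nbhs_singleton /= xN; apply: filterS (discr x) => _ ->.
Qed.
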